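(* Let $G$ be a finite group and consider the $(G,\mathcal{U})$-twirled quantum world for a unitary symmetry $(G,\mathcal{U})$. If a bipartite state $\rho^{AB}$ in this twirled quantum world acts as a shared reference frame state, then $\rho^{AB}$ is entangled in the twirled quantum world.
   Context: Each system $S$ has a finite-dimensional Hilbert space carrying a projective unitary representation $\{U^S_g\}_{g\in G}$, with superoperators $\mathcal{U}^S_g(O)=U^S_gO{U^S_g}^\dagger$; on a composite $AB$ the symmetry acts collectively, $\mathcal{U}^{AB}_g=\mathcal{U}^A_g\otimes\mathcal{U}^B_g$. The states of system $S$ in the $(G,\mathcal{U})$-twirled quantum world are exactly the density operators $\rho^S$ that are $(G,\mathcal{U})$-invariant, i.e. $\mathcal{U}^S_g(\rho^S)=\rho^S$ for all $g\in G$. The twirling map on $AB$ is $\frac{1}{|G|}\sum_{g\in G}\mathcal{U}^{AB}_g$. The relational group action on $AB$ is $\{\mathcal{I}^A\otimes\mathcal{U}^B_g\}_{g\in G}$, where $\mathcal{I}^A$ is the identity superoperator. A bipartite state acts as a shared reference frame state if and only if its image under the twirling map is not invariant under the relational group action (i.e. is changed by $\mathcal{I}^A\otimes\mathcal{U}^B_g$ for some $g\in G$). A bipartite state is separable in the twirled quantum world if it can be prepared by local operations of the twirled world and classical shared randomness, i.e. if $\rho^{AB}=\sum_i p_i\,\rho_i^A\otimes\rho_i^B$ (finite sum) with $p_i\ge 0$, $\sum_i p_i=1$, and all $\rho_i^A$ and $\rho_i^B$ being $(G,\mathcal{U})$-invariant states of $A$ and $B$ respectively. It is entangled in the twirled quantum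 world if it is not separable in this sense. *)

(* Defs.v *)
From HB Require Import structures.
From mathcomp Require Import all_boot all_order all_algebra all_fingroup.
From mathcomp Require Import spectral sesquilinear complex mxtens.
From mathcomp Require Import reals.

Set Implicit Arguments.
Unset Strict Implicit.
Unset Printing Implicit Defensive.

Import Order.TTheory GRing.Theory Num.Theory.
Local Open Scope ring_scope.
Local Open Scope complex_scope.

(* The Hilbert space of an n-dimensional system is C^n with C = R[i] and its
   standard inner product; that of a composite system is C^(m * n), the two
   factors being identified through [mxtens_index] as in [tensmx].  The symbol
   [^t] is used by both spectral.v and mxtens.v, hence the explicit adjoint. *)
Definition adjmx (R : realType) (m n : nat) (M : 'M[R[i]]_(m, n)) :
  'M[R[i]]_(n, m) := map_mx Num.conj M^T.

Definition projective_unitary_repr (R : realType) (G : finGroupType) (n : nat)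
    (U : G -> 'M[R[i]]_n) : Prop :=
  (forall g, U g \is unitarymx) /\
  (forall g h, exists2 c : R[i], `|c| = 1 & U g *m U h = c *: U (g * h)%g).

(* In the order of R[i], [0 <= z] means that z is real and nonnegative, so the
   first clause also forces rho to be Hermitian. *)
Definition density (R : realType) (n : nat) (rho : 'M[R[i]]_n) : Prop :=
  (forall v : 'cV[R[i]]_n, 0 <= (adjmx v *m rho *m v) 0 0) /\ \tr rho = 1.

Definition superop (R : realType) (n : nat) := 'M[R[i]]_n -> 'M[R[i]]_n.

Definition conj_superop (R : realType) (n : nat) (U : 'M[R[i]]_n) :
  superop R n := fun O => U *m O *m adjmx U.

(* The extension by linearity of (E (x) F)(X (x) Y) = E X (x) F Y, written in
   the basis of tensor products of matrix units. *)
Definition tens_superop (R : realType) (m n : nat) (E : superop R m)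
    (F : superop R n) : superop R (m * n) := fun M =>
  \sum_(i < m) \sum_(j < m) \sum_(k < n) \sum_(l < n)
     M (mxtens_index (i, k)) (mxtens_index (j, l)) *:
       tensmx (E (delta_mx i j)) (F (delta_mx k l)).

Definition local_action (R : realType) (G : finGroupType) (n : nat)
    (U : G -> 'M[R[i]]_n) : G -> superop R n :=
  fun g => conj_superop (U g).

Definition collective_action (R : realType) (G : finGroupType) (m n : nat)
    (UA : G -> 'M[R[i]]_m) (UB : G -> 'M[R[i]]_n) : G -> superop R (m * n) :=
  fun g => tens_superop (local_action UA g) (local_action UB g).

Definition relational_action (R : realType) (G : finGroupType) (m n : nat)
    (UB : G -> 'M[R[i]]_n) : G -> superop R (m * n) :=
  fun g => tens_superop (fun O : 'M[R[i]]_m => O) (local_action UB g).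

Definition invariant_under (R : realType) (G : finGroupType) (n : nat)
    (act : G -> superop R n) (O : 'M[R[i]]_n) : Prop :=
  forall g, act g O = O.

Definition twirled_state (R : realType) (G : finGroupType) (n : nat)
    (act : G -> superop R n) (rho : 'M[R[i]]_n) : Prop :=
  density rho /\ invariant_under act rho.

Definition twirling (R : realType) (G : finGroupType) (n : nat)
    (act : G -> superop R n) : superop R n :=
  fun O => (#|G|%:R)^-1 *: \sum_(g : G) act g O.

Definition shared_reference_frame (R : realType) (G : finGroupType) (m n : nat)
    (UA : G -> 'M[R[i]]_m) (UB : G -> 'M[R[i]]_n) (rho : 'M[R[i]]_(m * n)) :
    Prop :=
  ~ invariant_under (relational_action (m := m) UB)
      (twirling (collective_action UA UB) rho).

Definition twirled_separable (R : realType) (G : finGroupType) (m n : nat)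
    (UA : G -> 'M[R[i]]_m) (UB : G -> 'M[R[i]]_n) (rho : 'M[R[i]]_(m * n)) :
    Prop :=
  exists (N : nat) (p : 'I_N -> R)
         (rhoA : 'I_N -> 'M[R[i]]_m) (rhoB : 'I_N -> 'M[R[i]]_n),
    [/\ forall k, 0 <= p k,
        \sum_(k < N) p k = 1,
        forall k, twirled_state (local_action UA) (rhoA k),
        forall k, twirled_state (local_action UB) (rhoB k) &
        rho = \sum_(k < N) (p k)%:C *: tensmx (rhoA k) (rhoB k)].

Definition twirled_entangled (R : realType) (G : finGroupType) (m n : nat)
    (UA : G -> 'M[R[i]]_m) (UB : G -> 'M[R[i]]_n) (rho : 'M[R[i]]_(m * n)) :
    Prop :=
  ~ twirled_separable UA UB rho.

Lemma tens_superop_tensmx (R : realType) (m n : nat)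
    (E : {linear 'M[R[i]]_m -> 'M[R[i]]_m})
    (F : {linear 'M[R[i]]_n -> 'M[R[i]]_n}) (X : 'M_m) (Y : 'M_n) :
  tens_superop E F (tensmx X Y) = tensmx (E X) (F Y).
Proof.
rewrite {2}(matrix_sum_delta X) {2}(matrix_sum_delta Y) !linear_sum /=.
apply/matrixP => a b; case: (mxtens_indexP a) => a1 a2.
case: (mxtens_indexP b) => b1 b2; rewrite tensmxE !summxE big_distrl /=.
apply: eq_bigr => i _; rewrite linear_sum !summxE big_distrl /=.
apply: eq_bigr => j _; rewrite summxE big_distrr /=.
apply: eq_bigr => k _; rewrite linear_sum !summxE big_distrr /=.
apply: eq_bigr => l _; rewrite !linearZ /= !mxE !mxtens_indexK /=.
by rewrite mulrACA.
Qed.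

Lemma adjmx_tens (R : realType) (m n p q : nat) (A : 'M[R[i]]_(m, n))
    (B : 'M[R[i]]_(p, q)) : adjmx (tensmx A B) = tensmx (adjmx A) (adjmx B).
Proof. by apply/matrixP => a b; rewrite !mxE rmorphM. Qed.

Fact conj_superop_is_linear (R : realType) (n : nat) (U : 'M[R[i]]_n) :
  linear (conj_superop U).
Proof.
move=> a X Y; rewrite /conj_superop mulmxDr mulmxDl.
by rewrite -scalemxAr -scalemxAl.
Qed.

HB.instance Definition _ (R : realType) (n : nat) (U : 'M[R[i]]_n) :=
  GRing.isLinear.Build R[i] 'M[R[i]]_n 'M[R[i]]_n *:%R (conj_superop U)
    (conj_superop_is_linear U).

Lemma tensmx_sum_delta (R : realType) (m n : nat) (M : 'M[R[i]]_(m * n)) :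
  M = \sum_(i < m) \sum_(j < m) \sum_(k < n) \sum_(l < n)
    M (mxtens_index (i, k)) (mxtens_index (j, l)) *:
      tensmx (delta_mx i j) (delta_mx k l).
Proof.
apply/matrixP => a b; case: (mxtens_indexP a) => a1 a2.
case: (mxtens_indexP b) => b1 b2; rewrite summxE.
rewrite (bigD1 a1) //= [X in _ + X]big1 ?addr0; last first.
  move=> i ne; rewrite summxE big1 // => j _; rewrite summxE big1 // => k _.
  rewrite summxE big1 // => l _.
  by rewrite mxE tensmxE mxE eq_sym (negbTE ne) mul0r mulr0.
rewrite summxE (bigD1 b1) //= [X in _ + X]big1 ?addr0; last first.
  move=> j ne; rewrite summxE big1 // => k _; rewrite summxE big1 // => l _.
  by rewrite mxE tensmxE mxE [b1 == j]eq_sym (negbTE ne) andbF mul0r mulr0.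
rewrite summxE (bigD1 a2) //= [X in _ + X]big1 ?addr0; last first.
  move=> k ne; rewrite summxE big1 // => l _; rewrite mxE tensmxE.
  by rewrite [X in _ * (_ * X)]mxE eq_sym (negbTE ne) !mulr0.
rewrite summxE (bigD1 b2) //= [X in _ + X]big1 ?addr0; last first.
  move=> l ne; rewrite mxE tensmxE.
  by rewrite [X in _ * (_ * X)]mxE [b2 == l]eq_sym (negbTE ne) andbF !mulr0.
by rewrite mxE tensmxE !mxE !eqxx !mulr1.
Qed.

Lemma tens_superop_conj (R : realType) (m n : nat) (U : 'M[R[i]]_m)
    (V : 'M[R[i]]_n) :
  tens_superop (conj_superop U) (conj_superop V)
    =1 conj_superop (tensmx U V).
Proof.
move=> M; rewrite {2}(tensmx_sum_delta M) linear_sum; apply: eq_bigr => i _.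
rewrite linear_sum; apply: eq_bigr => j _.
rewrite linear_sum; apply: eq_bigr => k _.
rewrite linear_sum; apply: eq_bigr => l _.
by rewrite linearZ /= /conj_superop adjmx_tens !tensmx_mul.
Qed.

(* Main.v *)
(* A separable twirled state is fixed by the twirling map and is a combination
   of products whose B-factors are all invariant, so the relational action
   fixes it term by term. *)
Require Import Defs.
From mathcomp Require Import all_boot all_order all_algebra all_fingroup.
From mathcomp Require Import complex reals mxtens.

Local Open Scope ring_scope.
Local Open Scope complex_scope.

(** By contraposition. Twirling does nothing to a state of the twirled world ([twirling_invariant]),
    so being a reference frame means that the state itself is moved by the relational action. A
    separable one is not ([twirled_separable_relational]). *)

Lemma tens_superop_sum (R : realType) (m n : nat) (E : superop R m)
    (F : superop R n) (N : nat) (c : 'I_N -> R[i]) (X : 'I_N -> 'M_(m * n)) :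
  tens_superop E F (\sum_(k < N) c k *: X k) =
    \sum_(k < N) c k *: tens_superop E F (X k).
Proof.
(* The argument enters [tens_superop] only through its entries, as coefficients; the sum over [s]
   moves inward past the four sums over matrix units. *)
under [RHS]eq_bigr => s _ do rewrite GRing.scaler_sumr.
rewrite [RHS]exchange_big; apply: eq_bigr => i _ /=.
under [RHS]eq_bigr => s _ do rewrite GRing.scaler_sumr.
rewrite [RHS]exchange_big; apply: eq_bigr => j _ /=.
under [RHS]eq_bigr => s _ do rewrite GRing.scaler_sumr.
rewrite [RHS]exchange_big; apply: eq_bigr => k _ /=.
under [RHS]eq_bigr => s _ do rewrite GRing.scaler_sumr.
rewrite [RHS]exchange_big; apply: eq_bigr => l _ /=.
rewrite summxE GRing.scaler_suml; apply: eq_bigr => s _.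
by rewrite mxE GRing.scalerA.
Qed.

Lemma twirling_invariant (R : realType) (G : finGroupType) (n : nat)
    (act : G -> superop R n) (rho : 'M[R[i]]_n) :
  invariant_under act rho -> twirling act rho = rho.
Proof.
move=> inv_rho; rewrite /twirling (eq_bigr (fun=> rho)) => [|g _]; last first.
  exact: inv_rho.
rewrite GRing.sumr_const -[rho *+ _]GRing.scaler_nat GRing.scalerA
  GRing.mulVf ?GRing.scale1r //.
by rewrite Num.Theory.pnatr_eq0 -lt0n; apply/card_gt0P; exists 1%g.
Qed.

Lemma twirled_separable_relational (R : realType) (G : finGroupType) (m n : nat)
    (UA : G -> 'M[R[i]]_m) (UB : G -> 'M[R[i]]_n) (rho : 'M[R[i]]_(m * n)) :
  twirled_separable UA UB rho ->
  invariant_under (relational_action (m := m) UB) rho.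
Proof.
case=> [N [p [rhoA [rhoB [_ _ _ invB ->]]]]] g.
rewrite /relational_action tens_superop_sum; apply: eq_bigr => k _.
(* The identity on A is given as [idfun], which carries the linear structure that the product
   formula requires. *)
rewrite (tens_superop_tensmx idfun (conj_superop (UB g))) /=.
by have [_ /(_ g)] := invB k; rewrite /local_action => ->.
Qed.

Theorem theorem3 (R : realType) (G : finGroupType) (m n : nat)
    (UA : G -> 'M[R[i]]_m) (UB : G -> 'M[R[i]]_n)
    (hUA : projective_unitary_repr UA) (hUB : projective_unitary_repr UB)
    (rho : 'M[R[i]]_(m * n))
    (hrho : twirled_state (collective_action UA UB) rho) :
  shared_reference_frame UA UB rho -> twirled_entangled UA UB rho.
Proof.
move=> srf sep; apply: srf; have [_ inv_rho] := hrho.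
(* Collective invariance of [rho] removes the twirl. *)
by rewrite twirling_invariant //; apply: twirled_separable_relational sep.
Qed.
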